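(* Let $R$ and $S$ be commutative rings with identity, $f:R\to S$ a ring homomorphism (preserving identities), and $J$ a non-zero proper ideal of $S$. Assume that $Z(R)$ is an ideal of $R$, that $J$ is a regular ideal of $S$, and that $f^{-1}(J)$ is a regular ideal of $R$. If for some non-zero $k\in J$ and some non-zero element $f(x)+i\in f(R)+J$ (with $x\in R$, $i\in J$) we have $k(f(x)+i)=0$, then $\mathrm{diam}(\Gamma(R\bowtie^f J))=3$.
   Context: The amalgamation of $R$ with $S$ along $J$ with respect to $f$ is the subring $R\bowtie^f J=\{(r,f(r)+j)\mid r\in R,\ j\in J\}$ of $R\times S$. For a commutative ring $A$, $Z(A)$ is the set of zero-divisors of $A$ (including $0$); elements of $A\setminus Z(A)$ are called regular. An ideal of a ring is called regular if it contains a regular element of that ring. The zero-divisor graph $\Gamma(A)$ is the undirected graph with vertex set $Z(A)\setminus\{0\}$ in which distinct vertices $x,y$ are adjacent if and only if $xy=0$. The diameter $\mathrm{diam}(G)$ of a connected graph $G$ is the supremum of the distances (lengths of shortest paths) between its vertices. *)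

(* Defs.v *)
From HB Require Import structures.
From mathcomp Require Import all_boot all_order all_algebra.
From mathcomp Require Import boolp classical_sets.

Set Implicit Arguments.
Unset Strict Implicit.
Unset Printing Implicit Defensive.

Import GRing.Theory.

Local Open Scope ring_scope.

(* Subsets of rings are boolean predicates, so that [idealr] applies to them.  *)
(* This is no restriction: by [boolp.asboolP] every [P : A -> Prop] is         *)
(* reflected by the boolean predicate [fun x => `[< P x >]].                   *)

Section ZeroDivisors.
Variable A : comNzRingType.

(* 0 is included, since 1 != 0 in A *)
Definition zero_divisors : {pred A} :=
  [pred x | `[< exists2 y : A, y != 0 & x * y = 0 >]].

Definition regular (x : A) : Prop := x \notin zero_divisors.

Definition regular_ideal (I : idealr A) : Prop :=
  exists2 x : A, x \in I & regular x.

End ZeroDivisors.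

Section PreimageIdeal.
Variables (R S : comNzRingType) (f : {rmorphism R -> S}) (J : idealr S).

Definition preim_ideal : pred R := [pred x | f x \in J].

Lemma preim_ideal_closed : idealr_closed preim_ideal.
Proof.
split=> [||a u v]; rewrite !inE ?rmorph0 ?rmorph1 ?idealr0 ?idealr1 // => Ju Jv.
by rewrite rmorphD rmorphM rpredD // idealMr.
Qed.

HB.instance Definition _ := isIdealr.Build R preim_ideal preim_ideal_closed.

End PreimageIdeal.

Section Amalgamation.
Variables (R S : comNzRingType) (f : {rmorphism R -> S}) (J : idealr S).

Definition amalg_pred : {pred R * S} :=
  [pred p | `[< exists r : R, exists2 j : S, j \in J & p = (r, f r + j) >]].

Lemma amalg_subring : subring_closed amalg_pred.
Proof.
split.
- by apply/asboolP; exists 1, 0; rewrite ?idealr0 // rmorph1 addr0.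
- move=> _ _ /asboolP[r [j Jj ->]] /asboolP[s [k Jk ->]]; apply/asboolP.
  exists (r - s), (j - k); first by rewrite rpredB.
  by congr pair; rewrite /= rmorphB -addrACA -opprD.
move=> _ _ /asboolP[r [j Jj ->]] /asboolP[s [k Jk ->]]; apply/asboolP.
exists (r * s), (f r * k + (f s + k) * j).
  by rewrite rpredD // idealMr.
congr pair; rewrite /= rmorphM mulrDl mulrDr -addrA; congr (_ + (_ + _)).
by rewrite mulrC.
Qed.

Record amalg := Amalg { amalg_val :> R * S; _ : amalg_val \in amalg_pred }.

HB.instance Definition _ := [isSub for amalg_val].
HB.instance Definition _ := [Choice of amalg by <:].
HB.instance Definition _ :=
  GRing.SubChoice_isSubComNzRing.Build (R * S)%type amalg_pred amalg
    amalg_subring.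

End Amalgamation.

(* A graph is given by its vertex type and its adjacency relation. *)
Section Graph.
Variables (V : eqType) (adj : rel V).

(* the path visits x :: p, hence has length [size p] *)
Definition is_path (x y : V) (p : seq V) : Prop :=
  [/\ path adj x p, uniq (x :: p) & last x p = y].

Definition is_dist (x y : V) (n : nat) : Prop :=
  (exists2 p, is_path x y p & size p = n) /\
  (forall p, is_path x y p -> (n <= size p)%N).

Definition graph_connected : Prop := forall x y : V, exists p, is_path x y p.

Definition is_diam (n : nat) : Prop :=
  graph_connected /\
  supremums [set m : nat | exists x y : V, is_dist x y m]%classic n.

End Graph.

Section ZeroDivisorGraph.
Variable A : comNzRingType.

Definition zdg_vertex : Type :=
  {x : A | (x \in @zero_divisors A) && (x != 0)}.

HB.instance Definition _ := SubChoice.on zdg_vertex.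

Definition zdg : rel zdg_vertex :=
  [rel x y | (x != y) && (val x * val y == 0)].

End ZeroDivisorGraph.

(* Main.v *)
Require Import Defs.
From mathcomp Require Import all_boot all_order all_algebra.
From mathcomp Require Import boolp classical_sets.

(** The zero-divisor graph of any commutative ring is connected of diameter
    at most 3 (Anderson and Livingston): if [a] kills [x] and [b] kills [y],
    then [x - ab - y] or [x - a - b - y] is a walk, according to whether [ab]
    is non-zero ([zdg_short_path]).  The diameter is therefore exactly 3 as
    soon as two zero-divisors have non-zero product and no non-zero common
    annihilator ([zdg_diam3]).

    In the amalgamation, let [j] be a regular element of [S] in [J] and [r] a
    regular element of [R] with [f r] in [J].  Then [(0, j)] and [(r, 0)]
    belong to the amalgamation and annihilate each other.  The given relation
    [k (f x + i) = 0] says that [(0, k)] annihilates [(x, f x + i)], and this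
    remains so for [(x + r, f x + i)], which is also in the amalgamation.
    Since [Z(R)] is an ideal not containing [r], the elements [x] and [x + r]
    are not both in [Z(R)]; let [y] be a regular one.  The wanted zero-divisors
    are [(0, j)] and [(y, f x + i)]: their product [(0, j (f x + i))] is
    non-zero because [j] is regular, and a common annihilator [(s, t)] satisfies
    [t j = 0] and [s y = 0], hence vanishes. *)

Set Implicit Arguments.
Unset Strict Implicit.
Unset Printing Implicit Defensive.

Local Open Scope ring_scope.
Import GRing.Theory.

(** * Zero-divisors and regular elements *)

Section ZeroDivisorFacts.
Variable A : comNzRingType.
Implicit Types x y : A.

Lemma zero_divisorP x :
  reflect (exists2 y, y != 0 & x * y = 0) (x \in @zero_divisors A).
Proof. exact: asboolP. Qed.

Lemma zero_divisorI x y : y != 0 -> y * x = 0 -> x \in @zero_divisors A.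
Proof. by move=> y0 yx0; apply/zero_divisorP; exists y; rewrite // mulrC. Qed.

Lemma regular_eq0 x y : regular x -> y * x = 0 -> y = 0.
Proof.
by move=> xreg yx0; apply: contraNeq xreg => /zero_divisorI; apply.
Qed.

Lemma regular_neq0 x : regular x -> x != 0.
Proof.
move=> xreg; apply: contraNneq xreg => ->.
by apply: (zero_divisorI (oner_neq0 A)); rewrite mulr0.
Qed.

(** If [x] and [x + y] were both zero-divisors, so would be their difference
    [y]. *)
Lemma regular_shift x y : idealr_closed (@zero_divisors A) ->
  regular y -> regular x \/ regular (x + y).
Proof.
move=> [_ _ ZD] yreg.
have [xZ|] := boolP (x \in @zero_divisors A); last by left.
right; apply: contra yreg => xyZ.
by rewrite -(addKr x y) -mulN1r; apply: ZD.
Qed.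

End ZeroDivisorFacts.

(** * The zero-divisor graph of a commutative ring *)

(** Once its loops are removed, a walk has no two equal successive vertices;
    walks can thus be built without checking that their vertices differ. *)
Lemma is_path_of_walk (V : eqType) (e : rel V) (x : V) (p : seq V) :
  path e x p ->
  exists2 q, is_path [rel u v | (u != v) && e u v] x (last x p) q
           & (size q <= size p)%N.
Proof.
move=> /shortenP[q eq uq qp]; exists q; last first.
  by apply: uniq_leq_size qp; case/andP: uq.
split=> //; elim: q x {qp} eq uq => //= y q IHq x /andP[exy eq] /andP[xq uq].
by rewrite exy IHq // !andbT; move: xq; rewrite inE negb_or => /andP[].
Qed.

Section ZeroDivisorGraphDiameter.
Variable A : comNzRingType.
Implicit Types (x y : zdg_vertex A) (a b c : A).

Definition Vertex {a} (aZ : a \in @zero_divisors A) (a0 : a != 0) :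
  zdg_vertex A := exist _ a (introT andP (conj aZ a0)).

Lemma vertex_annihilator x :
  exists2 z : zdg_vertex A, val x * val z == 0 & val z * val x == 0.
Proof.
have /andP[/zero_divisorP[a a0 xa0] x0] := valP x.
by exists (Vertex (zero_divisorI x0 xa0) a0); last rewrite mulrC; apply/eqP.
Qed.

(** With [a] and [b] non-zero annihilators of [x] and [y], the walk is
    [x - ab - y] if [ab] is non-zero and [x - a - b - y] otherwise; coincidences
    among these vertices are removed by [is_path_of_walk]. *)
Lemma zdg_short_path x y :
  exists2 p, is_path (@zdg A) x y p & (size p <= 3)%N.
Proof.
suff [p [ep <- sp]] : exists p : seq (zdg_vertex A),
    [/\ path (fun u v => val u * val v == 0) x p, last x p = y
      & (size p <= 3)%N].
  by have [q xq sq] := is_path_of_walk ep; exists q; last exact: leq_trans sp.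
have [a xa ax] := vertex_annihilator x; have [b yb b_y] := vertex_annihilator y.
have [ab0|ab0] := eqVneq (val a * val b) 0.
  by exists [:: a; b; y]; split; rewrite //= xa ab0 eqxx b_y.
have /andP[_ x0] := valP x.
have xab : val x * (val a * val b) = 0 by rewrite mulrA (eqP xa) mul0r.
exists [:: Vertex (zero_divisorI x0 xab) ab0; y]; split=> //=.
by rewrite xab -mulrA (eqP b_y) mulr0 eqxx.
Qed.

(** A path of length at most 2 is trivial, an edge, or passes through a common
    annihilator of its ends; each is excluded.  The two ends differ, since a
    zero-divisor has a non-zero annihilator. *)
Lemma zdg_long_path x y : val x * val y != 0 ->
  (forall c, c * val x = 0 -> c * val y = 0 -> c = 0) ->
  forall p, is_path (@zdg A) x y p -> (3 <= size p)%N.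
Proof.
move=> xy0 ann [|u [|v [|w p]]] // [/= ep _ lp].
- have [z _ /eqP zx] := vertex_annihilator x; have /andP[_] := valP z.
  by rewrite (ann (val z)) ?eqxx // -lp.
- by move: ep xy0; rewrite lp andbT => /andP[_ /eqP ->]; rewrite eqxx.
- move: ep; rewrite lp => /and3P[/andP[_ /eqP xu] /andP[_ /eqP uy] _].
  by have /andP[_] := valP u; rewrite (ann (val u)) ?eqxx // mulrC.
Qed.

Lemma zdg_diam3 a b :
    a \in @zero_divisors A -> b \in @zero_divisors A -> a * b != 0 ->
    (forall c, c * a = 0 -> c * b = 0 -> c = 0) ->
  is_diam (@zdg A) 3.
Proof.
move=> aZ bZ ab0 ann.
have a0 : a != 0 by apply: contraNneq ab0 => ->; rewrite mul0r.
have b0 : b != 0 by apply: contraNneq ab0 => ->; rewrite mulr0.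
have long := @zdg_long_path (Vertex aZ a0) (Vertex bZ b0) ab0 ann.
split; first by move=> x y; have [p] := zdg_short_path x y; exists p.
split=> [m [x [y [_ dist_le]]]|m].
  by have [p /dist_le mp p3] := zdg_short_path x y; apply: leq_trans p3.
apply; exists (Vertex aZ a0), (Vertex bZ b0); split=> //.
have [p abp p3] := zdg_short_path (Vertex aZ a0) (Vertex bZ b0).
by exists p => //; apply/eqP; rewrite eqn_leq p3 long.
Qed.

End ZeroDivisorGraphDiameter.

(** * The amalgamation *)

Lemma amalg_predP {R S : comNzRingType} {f : {rmorphism R -> S}} {J : idealr S}
    (r : R) (s : S) :
  s - f r \in J -> (r, s) \in @amalg_pred R S f J.
Proof. by move=> Jsr; apply/asboolP; exists r, (s - f r); rewrite ?subrKC. Qed.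

Lemma amalg_eq {R S : comNzRingType} {f : {rmorphism R -> S}} {J : idealr S}
    (u v : amalg f J) :
  u.1 = v.1 -> u.2 = v.2 -> u = v.
Proof.
case: u v => [[u1 u2] uJ] [[v1 v2] vJ] /= e1 e2.
by apply: val_inj; rewrite /= e1 e2.
Qed.

Theorem proposition4p4 (R S : comNzRingType) (f : {rmorphism R -> S})
    (J : idealr S)
    (J_neq0 : exists2 j : S, j \in J & j != 0)
    (ZR_ideal : idealr_closed (@zero_divisors R))
    (J_regular : regular_ideal J)
    (preimJ_regular : regular_ideal (preim_ideal f J))
    (zero_product : exists k : S, exists x : R, exists i : S,
      [/\ k \in J, k != 0, i \in J, f x + i != 0 & k * (f x + i) = 0]) :
  is_diam (@zdg (amalg f J)) 3.
Proof.
have [j Jj jreg] := J_regular; have [r Jfr rreg] := preimJ_regular.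
have [k [x [i [Jk k0 Ji z0 kz0]]]] := zero_product.
move: Jfr; rewrite inE => Jfr; set z := f x + i in z0 kz0.
(* As [f r] lies in [J], the pair [(x + r, z)] is in the amalgamation too. *)
have [y yreg Jzy] : exists2 y, regular y & z - f y \in J.
  have [xreg|xrreg] := regular_shift x ZR_ideal rreg.
    by exists x; rewrite // /z addrC addKr.
  exists (x + r) => //.
  by rewrite /z rmorphD opprD addrACA subrr add0r rpredB.
have in0J s : s \in J -> s - f 0 \in J by rewrite rmorph0 subr0.
have Jr0 : 0 - f r \in J by rewrite sub0r rpredN.
pose a : amalg f J := Amalg (amalg_predP (in0J j Jj)).
pose b : amalg f J := Amalg (amalg_predP Jzy).
pose a' : amalg f J := Amalg (amalg_predP Jr0).
pose b' : amalg f J := Amalg (amalg_predP (in0J k Jk)).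
have eq1 (u v : amalg f J) : u = v -> u.1 = v.1 by move=> ->.
have eq2 (u v : amalg f J) : u = v -> u.2 = v.2 by move=> ->.
apply: (@zdg_diam3 _ a b).
- apply: (@zero_divisorI _ _ a').
    by apply: contraNneq (regular_neq0 rreg) => /eq1 /= ->.
  by apply: amalg_eq; rewrite /= ?mulr0 ?mul0r.
- apply: (@zero_divisorI _ _ b').
    by apply: contraNneq k0 => /eq2 /= ->.
  by apply: amalg_eq; rewrite /= ?mul0r ?kz0.
- apply: contraNneq z0 => /eq2 /=.
  by rewrite mulrC => /(regular_eq0 jreg) ->.
move=> c /eq2 /= /(regular_eq0 jreg) c2.
move=> /eq1 /= /(regular_eq0 yreg) c1.
exact: amalg_eq.
Qed.
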